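(* Consider the semi-implicit finite volume scheme for the five-moment system with BGK source (relaxation time $\tau>0$) on a uniform grid of size $\Delta x>0$ with time step $\Delta t_n>0$, $$\overline{\mathbf M}^{n+1}_i=\overline{\mathbf M}^n_i-\frac{\Delta t_n}{\Delta x}\Big(\widehat{\mathbf F}(\mathbf M^{n,-}_{i+\frac12},\mathbf M^{n,+}_{i+\frac12})-\widehat{\mathbf F}(\mathbf M^{n,-}_{i-\frac12},\mathbf M^{n,+}_{i-\frac12})\Big)+\frac{\Delta t_n}{\tau}\Big(\rho\boldsymbol\Delta^n_i-\overline{\mathbf M}^{n+1}_i\Big),$$ where $\rho\boldsymbol\Delta^n_i$ is the Maxwellian moment vector, $\mathbf F$ is the flux of either the two-node Gaussian-EQMOM closure or the three-point HyQMOM closure, $\widehat{\mathbf F}$ is the corresponding HLL flux, and the interface values are obtained by linear reconstruction (all specified in the context). If $\overline{\mathbf M}^n_i$ and the reconstructed values $\mathbf M^{n,\pm}_{i+\frac12}$ are strictly realizable for all $i$, then the updated $\overline{\mathbf M}^{n+1}_i$ is strictly realizable for all $i$, for both Gaussian-EQMOM and HyQMOM, under the CFL condition $$\frac{\Delta t_n}{\Delta x}\max_i\big\{\delta^{n,+}_{i+\frac12}-\delta^{n,-}_{i+\frac12}\big\}\le\frac12.$$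
   Context: **Realizability.** A vector $\mathbf M=(M_0,\dots,M_4)^\top\in\mathbb R^5$ is realizable if there is a nonnegative distribution (finite nonnegative Borel measure, e.g. a sum of Dirac masses) $f$ on $\mathbb R$ with $M_k=\int_{\mathbb R} v^k\,df(v)$, $k=0,\dots,4$. It is strictly realizable if it lies in the interior $\Omega_2$ of the set of realizable vectors; equivalently, its Hankel matrix $\mathcal H_2(\mathbf M)=(M_{j+k})_{0\le j,k\le2}$ is positive definite. **Maxwellian moments.** $\boldsymbol\Delta=(\Delta_0(U,\theta),\dots,\Delta_4(U,\theta))^\top$, where $\Delta_k(U,\theta)=\int_{\mathbb R}v^k\frac1{\sqrt{2\pi\theta}}e^{-(v-U)^2/(2\theta)}\,dv$, $\rho=M_0$, $U=M_1/M_0$, $\theta=M_2/M_0-U^2$; $\rho\boldsymbol\Delta^n_i$ is this quantity evaluated at the cell average $\overline{\mathbf M}^n_i$ (so $\rho>0$, $\theta>0$ and it is strictly realizable). **Flux.** $\mathbf F(\mathbf M)=(M_1,M_2,M_3,M_4,\overline M_5)^\top$, where $\overline M_5$ is given by one of the following closures. (G) Two-node Gaussian-EQMOM: there are primitive variables $(\rho_1,v_1,\rho_2,v_2,\sigma)$ with $\rho_1,\rho_2,\sigma>0$ solving $M_0=\rho_1+\rho_2$, $M_1=\rho_1v_1+\rho_2v_2$, $M_2=\rho_1v_1^2+\rho_2v_2^2+\sigma^2M_0$, $M_3=\rho_1v_1^3+\rho_2v_2^3+3\sigma^2M_1$, $M_4=\rho_1v_1^4+\rho_2v_2^4+6\sigma^2M_2-3\sigma^4M_0$,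 and $\overline M_5=\rho_1v_1^5+\rho_2v_2^5+10\sigma^2M_3-15\sigma^4M_1$ (the fifth moment of the sum of the Gaussians with weights $\rho_i$, means $v_i$ and variance $\sigma^2$). Standing assumption: all strictly realizable vectors at which $\mathbf F$ is evaluated admit such primitive variables (this only excludes a measure-zero subset of $\Omega_2$). For a fixed constant $a>\sqrt3$ set $\delta^+(\mathbf M)=\max\{v_1+a\sigma,v_2+a\sigma,0\}$, $\delta^-(\mathbf M)=\min\{v_1-a\sigma,v_2-a\sigma,0\}$. (H) Three-point HyQMOM: the primitive variables $\rho_1,\rho_2,\rho_3>0$, $v_1,v_3$ solve $M_k=\sum_{i=1}^3\rho_iv_i^k$ for $k=0,\dots,4$ with $v_2=M_1/M_0$, and $\overline M_5=\sum_{i=1}^3\rho_iv_i^5$. Set $\delta^+(\mathbf M)=\max\{v_1,v_2,v_3,0\}$, $\delta^-(\mathbf M)=\min\{v_1,v_2,v_3,0\}$. **HLL flux.** $$\widehat{\mathbf F}(\mathbf M^-,\mathbf M^+)=\frac{\hat\delta^+\mathbf F(\mathbf M^-)-\hat\delta^-\mathbf F(\mathbf M^+)+\hat\delta^+\hat\delta^-(\mathbf M^+-\mathbf M^-)}{\hat\delta^+-\hat\delta^-},$$ with $\hat\delta^+=\max\{\delta^+(\mathbf M^+),\delta^+(\mathbf M^-)\}$ and $\hat\delta^-=\min\{\delta^-(\mathbf M^+),\delta^-(\mathbf M^-)\}$. The interface speeds $\delta^{n,\pm}_{i+\frac12}$ are the values of $\hat\delta^\pm$ at $(\mathbf M^{n,+}_{i+\frac12},\mathbf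 M^{n,-}_{i+\frac12})$. **Reconstruction.** $\mathbf M^{n,\mp}_{i\pm\frac12}=\overline{\mathbf M}^n_i\pm\frac{\Delta x}{2}(\widehat{\mathbf M}^n_x)_i$, where the slope $(\widehat{\mathbf M}^n_x)_i$ is computed componentwise by the van Albada limiter: with $p=(\overline{M}_{i+1}-\overline{M}_i)/\Delta x$, $m=(\overline{M}_i-\overline{M}_{i-1})/\Delta x$ for a given component, the slope is $\frac{(p^2+\varepsilon_R)m+(m^2+\varepsilon_L)p}{m^2+p^2+\varepsilon_L+\varepsilon_R}$ with $\varepsilon_L=\varepsilon_R=3\Delta x$. The index $i$ runs over all grid cells, and the maximum is over all cell interfaces. *)

(* Defs.v *)
From HB Require Import structures.
From mathcomp Require Import all_boot all_order all_algebra.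
From mathcomp Require Import all_classical all_reals all_analysis.

Set Implicit Arguments.
Unset Strict Implicit.
Unset Printing Implicit Defensive.

Import Order.TTheory GRing.Theory Num.Theory.
Import numFieldNormedType.Exports.

Local Open Scope classical_set_scope.
Local Open Scope ring_scope.

Definition moment {R : realType} (M : 'rV[R]_5) (k : nat) : R :=
  M ord0 (inord k).

(* Integrability is required explicitly because the Lebesgue integral is
   total. *)
Definition realizable {R : realType} : set 'rV[R]_5 :=
  [set M | exists f : {finite_measure set (measurableTypeR R) -> \bar R},
     forall k : nat, (k <= 4)%N ->
       f.-integrable setT (fun v : measurableTypeR R => (v ^+ k)%:E) /\
       (\int[f]_v (v ^+ k)%:E)%E = (moment M k)%:E].

Definition strictly_realizable {R : realType} : set 'rV[R]_5 :=
  interior realizable.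

Definition maxwellian {R : realType} (U theta : R) : 'rV[R]_5 :=
  \row_(k < 5) \int[@lebesgue_measure R]_(v in setT)
    (v ^+ k * (expR (- (v - U) ^+ 2 / (2 * theta))
               / Num.sqrt (2 * pi * theta))).

Definition rho_maxwellian {R : realType} (M : 'rV[R]_5) : 'rV[R]_5 :=
  let rho := moment M 0 in
  let U := moment M 1 / moment M 0 in
  let theta := moment M 2 / moment M 0 - U ^+ 2 in
  rho *: maxwellian U theta.

(* Primitive variables (rho1, v1, rho2, v2, sigma). *)
Definition eqmom_primitive {R : realType} (M : 'rV[R]_5) :
    set (R * R * R * R * R) :=
  [set p | let '(r1, v1, r2, v2, s) := p in
    [/\ 0 < r1, 0 < r2 & 0 < s] /\
    [/\ moment M 0 = r1 + r2,
        moment M 1 = r1 * v1 + r2 * v2,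
        moment M 2 = r1 * v1 ^+ 2 + r2 * v2 ^+ 2 + s ^+ 2 * moment M 0,
        moment M 3 = r1 * v1 ^+ 3 + r2 * v2 ^+ 3 + 3 * s ^+ 2 * moment M 1
      & moment M 4 = r1 * v1 ^+ 4 + r2 * v2 ^+ 4 + 6 * s ^+ 2 * moment M 2
                     - 3 * s ^+ 4 * moment M 0]].

(* Primitive variables (rho1, rho2, rho3, v1, v3); v2 is the mean velocity. *)
Definition hyqmom_primitive {R : realType} (M : 'rV[R]_5) :
    set (R * R * R * R * R) :=
  [set p | let '(r1, r2, r3, v1, v3) := p in
    let v2 := moment M 1 / moment M 0 in
    [/\ 0 < r1, 0 < r2 & 0 < r3] /\
    forall k : nat, (k <= 4)%N ->
      moment M k = r1 * v1 ^+ k + r2 * v2 ^+ k + r3 * v3 ^+ k].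

(* At a strictly realizable vector the primitive variables, when they exist,
   are unique up to exchanging the nodes (and, for Gaussian-EQMOM with v1 = v2,
   up to the splitting of the mass between the two equal nodes). None of the
   quantities computed from them below depends on the solution chosen here. *)
Definition eqmom_inv {R : realType} (M : 'rV[R]_5) : R * R * R * R * R :=
  xget (0, 0, 0, 0, 0) (eqmom_primitive M).

Definition hyqmom_inv {R : realType} (M : 'rV[R]_5) : R * R * R * R * R :=
  xget (0, 0, 0, 0, 0) (hyqmom_primitive M).

Inductive closure_kind := GaussianEQMOM | HyQMOM.

Definition moment5 {R : realType} (c : closure_kind) (M : 'rV[R]_5) : R :=
  match c with
  | GaussianEQMOM =>
      let '(r1, v1, r2, v2, s) := eqmom_inv M in
      r1 * v1 ^+ 5 + r2 * v2 ^+ 5 + 10 * s ^+ 2 * moment M 3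
      - 15 * s ^+ 4 * moment M 1
  | HyQMOM =>
      let '(r1, r2, r3, v1, v3) := hyqmom_inv M in
      let v2 := moment M 1 / moment M 0 in
      r1 * v1 ^+ 5 + r2 * v2 ^+ 5 + r3 * v3 ^+ 5
  end.

Definition flux {R : realType} (c : closure_kind) (M : 'rV[R]_5) : 'rV[R]_5 :=
  \row_(k < 5) if (k < 4)%N then moment M k.+1 else moment5 c M.

(* The parameter a is only used by Gaussian-EQMOM. *)
Definition delta_plus {R : realType} (c : closure_kind) (a : R)
    (M : 'rV[R]_5) : R :=
  match c with
  | GaussianEQMOM =>
      let '(r1, v1, r2, v2, s) := eqmom_inv M in
      Num.max (Num.max (v1 + a * s) (v2 + a * s)) 0
  | HyQMOM =>
      let '(r1, r2, r3, v1, v3) := hyqmom_inv M in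
      let v2 := moment M 1 / moment M 0 in
      Num.max (Num.max (Num.max v1 v2) v3) 0
  end.

Definition delta_minus {R : realType} (c : closure_kind) (a : R)
    (M : 'rV[R]_5) : R :=
  match c with
  | GaussianEQMOM =>
      let '(r1, v1, r2, v2, s) := eqmom_inv M in
      Num.min (Num.min (v1 - a * s) (v2 - a * s)) 0
  | HyQMOM =>
      let '(r1, r2, r3, v1, v3) := hyqmom_inv M in
      let v2 := moment M 1 / moment M 0 in
      Num.min (Num.min (Num.min v1 v2) v3) 0
  end.

Definition speed_plus {R : realType} (c : closure_kind) (a : R)
    (Mm Mp : 'rV[R]_5) : R :=
  Num.max (delta_plus c a Mp) (delta_plus c a Mm).

Definition speed_minus {R : realType} (c : closure_kind) (a : R)
    (Mm Mp : 'rV[R]_5) : R :=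
  Num.min (delta_minus c a Mp) (delta_minus c a Mm).

Definition hll_flux {R : realType} (c : closure_kind) (a : R)
    (Mm Mp : 'rV[R]_5) : 'rV[R]_5 :=
  let dp := speed_plus c a Mm Mp in
  let dm := speed_minus c a Mm Mp in
  (dp - dm)^-1 *:
    (dp *: flux c Mm - dm *: flux c Mp + (dp * dm) *: (Mp - Mm)).

Definition van_albada {R : realType} (epsL epsR p m : R) : R :=
  ((p ^+ 2 + epsR) * m + (m ^+ 2 + epsL) * p)
  / (m ^+ 2 + p ^+ 2 + epsL + epsR).

Definition slope {R : realType} (dx : R) (M : int -> 'rV[R]_5) (i : int) :
    'rV[R]_5 :=
  \row_(k < 5)
    van_albada (3 * dx) (3 * dx)
      ((M (i + 1) ord0 k - M i ord0 k) / dx)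
      ((M i ord0 k - M (i - 1) ord0 k) / dx).

(* Interface i + 1/2, between cells i and i + 1, is indexed by i:
   [recon_minus dx M i] is the left state, reconstructed in cell i, and
   [recon_plus dx M i] the right state, reconstructed in cell i + 1. *)
Definition recon_minus {R : realType} (dx : R) (M : int -> 'rV[R]_5)
    (i : int) : 'rV[R]_5 :=
  M i + (dx / 2) *: slope dx M i.

Definition recon_plus {R : realType} (dx : R) (M : int -> 'rV[R]_5)
    (i : int) : 'rV[R]_5 :=
  M (i + 1) - (dx / 2) *: slope dx M (i + 1).

Definition num_flux {R : realType} (c : closure_kind) (a dx : R)
    (M : int -> 'rV[R]_5) (i : int) : 'rV[R]_5 :=
  hll_flux c a (recon_minus dx M i) (recon_plus dx M i).

Definition speed_gap {R : realType} (c : closure_kind) (a dx : R)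
    (M : int -> 'rV[R]_5) (i : int) : R :=
  speed_plus c a (recon_minus dx M i) (recon_plus dx M i)
  - speed_minus c a (recon_minus dx M i) (recon_plus dx M i).

(* Main.v *)
Require Import Defs.
From HB Require Import structures.
From mathcomp Require Import all_boot all_order all_algebra.
From mathcomp Require Import all_classical all_reals all_analysis.
From mathcomp Require Import measurable_realfun ring lra.

Set Implicit Arguments.
Unset Strict Implicit.
Unset Printing Implicit Defensive.

Import Order.TTheory GRing.Theory Num.Theory.
Import numFieldNormedType.Exports.

Local Open Scope classical_set_scope.
Local Open Scope ring_scope.

(** Why the scheme preserves strict realizability.

    Write P(x) = (1, x, ..., x^4), the moment vector of a Dirac mass at x.  A
    state M of either closure is a nonnegative combination sum_j w_j P(x_j) of
    such atoms, in such a way that its flux is F(M) = sum_j w_j x_j P(x_j) and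
    that every node x_j lies between delta^-(M) and delta^+(M) (predicate
    [quadrature]).  For HyQMOM the nodes are those of the closure.  They exist
    because positivity of M on the square of a suitable quadratic polynomial is
    what makes the three weights positive ([hyqmom_primitive_exists]).  For
    Gaussian-EQMOM the three-point Gauss-Hermite rule integrates each Gaussian
    exactly up to degree five, and its nodes v, v +- sqrt 3 sigma lie within
    v +- a sigma because sqrt 3 < a ([eqmom_quadrature]).

    Put lambda = dt / dx.  Substituting these representations in the HLL flux
    Fhat turns M^-/2 - lambda Fhat(M^-, M^+) and
    M^+/2 + lambda Fhat(M^-, M^+) into combinations of the P(x_j) whose
    coefficients are nonnegative as soon as lambda (delta^+ - delta^-) <= 1/2
    ([hll_outflow_realizable], [hll_inflow_realizable]).  The reconstruction
    being linear, a cell average is the mean of its two interface states, so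
    the transport step is the sum of one vector of each kind, hence realizable.

    Strictness comes from the collision term alone.  The update is a
    combination, with positive coefficients, of the realizable transported
    vector and of the Maxwellian moments.  The latter are a combination of five
    distinct atoms with positive weights ([maxwellian_quadrature]), and adding
    such a combination to a realizable vector gives an interior point: by
    invertibility of the Vandermonde matrix, every small perturbation can be
    absorbed in the five weights ([strictly_realizableD5]).  The Gaussian
    moments are found by integrating the derivative of v^k times the density,
    whose integral vanishes ([normal_moment_rec]). *)

(** * Atoms and realizable vectors *)

(** The moments of the Dirac mass at [x]. *)
Definition powers {R : realType} (x : R) : 'rV[R]_5 := \row_(k < 5) x ^+ k.

Definition atomic {R : realType} (s : seq (R * R)) : 'rV[R]_5 :=
  \sum_(p <- s) p.1 *: powers p.2.

Section MeasureAdd.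
Context d (T : measurableType d) (R : realType).
Variables m1 m2 : {measure set T -> \bar R}.
HB.instance Definition _ := Measure.copy (measure_add m1 m2)
  (msum (fun n => if n is 0%N then m1 else m2) 2).
End MeasureAdd.

Section FiniteMeasureAdd.
Context d (T : measurableType d) (R : realType).
Variables mu nu : {finite_measure set T -> \bar R}.

Let measure_add_fin_num : fin_num_fun (measure_add mu nu).
Proof.
by move=> A mA; rewrite measure_addE fin_numD !fin_num_measure.
Qed.

HB.instance Definition _ :=
  Measure_isFinite.Build _ _ _ (measure_add mu nu) measure_add_fin_num.

End FiniteMeasureAdd.

Lemma measurable_powere (R : realType) k :
  measurable_fun setT (fun v : measurableTypeR R => (v ^+ k)%:E).
Proof. by apply/measurable_EFinP; exact: measurable_funX. Qed.

Lemma realizableD (R : realType) (M N : 'rV[R]_5) :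
  realizable M -> realizable N -> realizable (M + N).
Proof.
move=> [f fM] [g gN]; exists (measure_add f g) => k k4.
have [fI fE] := fM k k4; have [gI gE] := gN k k4.
split; last first.
  rewrite (integral_measure_add _ fI gI)//.
  by rewrite fE gE /moment mxE.
apply/integrableP; split; first exact: measurable_powere.
rewrite ge0_integral_measure_add//; last first.
  by apply: measurableT_comp; [|exact: measurable_powere].
by rewrite lte_add_pinfty//;
  [have /integrableP[] := fI|have /integrableP[] := gI].
Qed.

Lemma realizableZ (R : realType) (w : R) (M : 'rV[R]_5) :
  0 <= w -> realizable M -> realizable (w *: M).
Proof.
move=> w0 [f fM]; exists (mscale (NngNum w0) f) => k k4.
have [fI fE] := fM k k4; have mX := @measurable_powere R k.
have scaleE := ge0_integral_mscale f measurableT (NngNum w0).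
split.
  apply/integrableP; split => //.
  rewrite scaleE//; last exact: measurableT_comp.
  by rewrite lte_mul_pinfty// ?lee_fin//; have /integrableP[] := fI.
have [mp mn] := (measurable_funepos mX, measurable_funeneg mX).
rewrite integralE !scaleE// -muleBr//; last first.
  by rewrite fin_num_adde_defr// integrable_pos_fin_num.
by rewrite -integralE fE /moment mxE EFinM.
Qed.

Lemma realizable_powers (R : realType) (x : R) : realizable (powers x).
Proof.
exists (dirac (x : measurableTypeR R)) => k k4.
have mX := @measurable_powere R k.
split; last first.
  by rewrite integral_dirac// diracT mul1e /moment mxE inordK.
apply/integrableP; split => //.
rewrite integral_dirac ?diracT ?mul1e ?ltry//; exact: measurableT_comp.
Qed.

Lemma realizable_atom (R : realType) (w x : R) :
  0 <= w -> realizable (w *: powers x).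
Proof. by move=> w0; apply: realizableZ => //; exact: realizable_powers. Qed.

Lemma realizable_atomic (R : realType) (s : seq (R * R)) :
  (forall p, p \in s -> 0 <= p.1) -> realizable (atomic s).
Proof.
elim: s => [|p s IH] s0; rewrite /atomic ?big_nil ?big_cons.
  by rewrite -(scale0r (powers 0)); exact: realizable_atom.
apply: realizableD; first by apply/realizable_atom/s0; rewrite mem_head.
by apply: IH => q qs; apply: s0; rewrite in_cons qs orbT.
Qed.

Lemma forall_le4 (P : nat -> Prop) : P 0 -> P 1 -> P 2 -> P 3 -> P 4 ->
  forall k, (k <= 4)%N -> P k.
Proof. by move=> P0 P1 P2 P3 P4 [|[|[|[|[]]]]]. Qed.

Lemma eq_moment (R : realType) (M N : 'rV[R]_5) :
  (forall k, (k <= 4)%N -> moment M k = moment N k) -> M = N.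
Proof.
move=> MN; apply/rowP => k; have := MN k (leq_ord k).
by rewrite /moment inord_val.
Qed.

Lemma moment_row (R : realType) (F : nat -> R) k :
  (k <= 4)%N -> moment (\row_(j < 5) F j) k = F k.
Proof. by move=> k4; rewrite /moment mxE inordK. Qed.

Lemma moment_atomic (R : realType) (s : seq (R * R)) k :
  (k <= 4)%N -> moment (atomic s) k = \sum_(p <- s) p.1 * p.2 ^+ k.
Proof.
move=> k4; rewrite /atomic /moment summxE; apply: eq_bigr => p _.
by rewrite mxE -/(moment _ _) moment_row.
Qed.

(** * Interior of the realizable set *)

(** Five distinct atoms form a basis of the moment space, and the coordinates
    in this basis depend continuously on the vector.  So if all five weights
    are positive they remain positive nearby, while [M] is kept fixed. *)
Lemma strictly_realizableD5 (R : realType) (x w : 'I_5 -> R) (M : 'rV[R]_5) :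
  injective x -> (forall j, 0 < w j) -> realizable M ->
  strictly_realizable (M + \sum_j w j *: powers (x j)).
Proof.
move=> xI w0 Mr.
pose X : 'M[R]_5 := \matrix_j powers (x j).
have rowX W : W *m X = \sum_j W 0 j *: powers (x j).
  by rewrite mulmx_sum_row; apply: eq_bigr => j _; rewrite rowK.
have XU : X \in unitmx.
  have -> : X = (Vandermonde 5 (\row_j x j))^T.
    by apply/matrixP => i j; rewrite !mxE.
  rewrite unitmx_tr unitmxE det_Vandermonde unitfE.
  apply/prodf_neq0 => i _; apply/prodf_neq0 => j ij.
  rewrite !mxE subr_eq0; apply: contraTneq ij => /xI ->.
  by rewrite ltnn.
pose weight N := (N - M) *m invmx X.
have weightK N : N = M + \sum_j weight N 0 j *: powers (x j).
  by rewrite -rowX mulmxKV// addrC subrK.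
rewrite /strictly_realizable /interior /=.
set N0 := M + _.
have wN0 j : weight N0 0 j = w j.
  rewrite /weight /N0 addrC addKr.
  have -> : \sum_j w j *: powers (x j) = (\row_j w j) *m X.
    by rewrite rowX; apply: eq_bigr => i _; rewrite mxE.
  by rewrite mulmxK// mxE.
have weight_cvg N1 j : weight N 0 j @[N --> N1] --> weight N1 0 j.
  rewrite /weight mxE; under eq_fun do rewrite mxE.
  apply: (cvg_big (@add_continuous R) (nbhs_filter N1)) => i _.
  apply: cvgMr_tmp; rewrite !mxE; under eq_fun do rewrite !mxE.
  by apply: cvgB; [exact: coord_continuous|exact: cvg_cst].
have : \forall N \near N0, forall j, 0 < weight N 0 j.
  apply: (filter_forall (nbhs_filter N0)) => j.
  apply: (cvgr_gt _ (weight_cvg N0 j)).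
  by rewrite wN0.
apply: filterS => N Nw; rewrite (weightK N).
apply: realizableD => //.
elim/big_rec: _ => [|j A _ Ar].
  by rewrite -(scale0r (powers 0)); exact: realizable_atom.
by apply: realizableD => //; apply: realizable_atom; exact/ltW/Nw.
Qed.

(** The integral of the polynomial with coefficients [p] against a measure with
    moments [M]. *)
Definition pairing {R : realType} (p M : 'rV[R]_5) : R :=
  \sum_k p 0 k * M 0 k.

Lemma realizable_pairing_ge0 (R : realType) (p M : 'rV[R]_5) :
  realizable M -> (forall x, 0 <= pairing p (powers x)) -> 0 <= pairing p M.
Proof.
move=> [f fM] p0.
have fMo (k : 'I_5) := fM k (leq_ord k).
rewrite -lee_fin /pairing -sumEFin.
have -> : (\sum_(k < 5) (p 0 k * M 0 k)%:E =
    \int[f]_v \sum_(k < 5) (p 0%R k)%:E * (v ^+ k)%:E)%E.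
  rewrite integral_sum//; last first.
    by move=> k; apply: integrableZl => //; case: (fMo k).
  apply: eq_bigr => k _; have [kI kE] := fMo k.
  rewrite integralZl// kE EFinM /moment; congr (_ * (M _ _)%:E)%E.
  by apply: val_inj; rewrite /= inordK.
apply: integral_ge0 => v _; rewrite sumEFin lee_fin.
by have := p0 v; rewrite /pairing; under eq_bigr do rewrite mxE.
Qed.

(** An interior point can be moved a little against the direction [p]; the
    moved vector still pairs nonnegatively with [p], and the displacement costs
    a positive multiple of the squared norm of [p]. *)
Lemma strictly_realizable_pairing_gt0 (R : realType) (p M : 'rV[R]_5) :
  strictly_realizable M -> p != 0 -> (forall x, 0 <= pairing p (powers x)) ->
  0 < pairing p M.
Proof.
move=> Mi pn0 p0.
have : M - e *: p @[e --> (0 : R)] --> M.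
  rewrite -[X in _ --> X]subr0 -(scale0r p).
  apply: cvgB; first exact: cvg_cst.
  by apply: cvgZr_tmp; exact: cvg_id.
move=> /(_ _ Mi) /nbhs_ballP [e /= e0 eM].
have /eM /realizable_pairing_ge0 /(_ p0) : ball 0 e (e / 2).
  rewrite /ball /= sub0r normrN gtr0_norm ?divr_gt0//.
  by rewrite gtr_pMr// invf_lt1 ?ltr1n.
have -> : pairing p (M - (e / 2) *: p) =
    pairing p M - (e / 2) * \sum_k p 0 k ^+ 2.
  rewrite /pairing mulr_sumr -sumrB; apply: eq_bigr => k _; rewrite !mxE.
  by ring.
rewrite subr_ge0; apply: lt_le_trans; apply: mulr_gt0; first exact: divr_gt0.
rewrite lt_def sumr_ge0 ?andbT => [|k _]; last exact: sqr_ge0.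
apply: contra pn0; rewrite psumr_eq0 => [/allP pk|k _]; last exact: sqr_ge0.
apply/eqP/rowP => k; rewrite mxE; apply/eqP.
by rewrite -sqrf_eq0; apply: pk; rewrite mem_index_enum.
Qed.

Lemma pairing_moment (R : realType) (p M : 'rV[R]_5) :
  pairing p M = \sum_(k < 5) moment p k * moment M k.
Proof. by apply: eq_bigr => k _; rewrite /moment inord_val. Qed.

Lemma strictly_realizable_poly_gt0 (R : realType) (M : 'rV[R]_5)
    (a b c d e : R) :
  strictly_realizable M ->
  let p x := a + b * x + c * x ^+ 2 + d * x ^+ 3 + e * x ^+ 4 in
  (forall x, 0 <= p x) -> (exists x, p x != 0) ->
  0 < a * moment M 0 + b * moment M 1 + c * moment M 2 + d * moment M 3
      + e * moment M 4.
Proof.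
move=> Mi p p0 [x px].
pose q : 'rV[R]_5 := \row_(k < 5) [:: a; b; c; d; e]`_k.
have qE N : pairing q N = a * moment N 0 + b * moment N 1 + c * moment N 2
    + d * moment N 3 + e * moment N 4.
  rewrite pairing_moment !big_ord_recr big_ord0 /= add0r.
  by rewrite !(@moment_row R (nth 0 _)).
have qpE y : pairing q (powers y) = p y.
  by rewrite qE !(@moment_row R (fun k => y ^+ k))//= expr0 expr1 mulr1.
rewrite -qE; apply: strictly_realizable_pairing_gt0 => // [|y].
  apply: contraNneq px => q0; rewrite -qpE q0 /pairing big1// => k _.
  by rewrite mxE mul0r.
by rewrite qpE.
Qed.

Lemma strictly_realizable_mass_gt0 (R : realType) (M : 'rV[R]_5) :
  strictly_realizable M -> 0 < moment M 0.
Proof.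
move=> /(@strictly_realizable_poly_gt0 R _ 1 0 0 0 0) /= H.
have := H _ _; rewrite !mul0r !addr0 mul1r; apply.
  by move=> x; rewrite !mul0r !addr0.
by exists 0; rewrite !mul0r !addr0 oner_eq0.
Qed.

Lemma strictly_realizable_variance_gt0 (R : realType) (M : 'rV[R]_5) :
  strictly_realizable M ->
  0 < moment M 2 / moment M 0 - (moment M 1 / moment M 0) ^+ 2.
Proof.
move=> Mi; have m0 := strictly_realizable_mass_gt0 Mi.
set U := moment M 1 / moment M 0.
have m1 : moment M 1 = U * moment M 0 by rewrite divfK ?gt_eqF.
have pE x : U ^+ 2 + - 2 * U * x + 1 * x ^+ 2 + 0 * x ^+ 3 + 0 * x ^+ 4 =
    (x - U) ^+ 2 by ring.
have H := @strictly_realizable_poly_gt0 R _ (U ^+ 2) (- 2 * U) 1 0 0 Mi.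
have {}H : 0 < moment M 2 - U ^+ 2 * moment M 0.
  have <- : U ^+ 2 * moment M 0 + -2 * U * moment M 1 + 1 * moment M 2 +
    0 * moment M 3 + 0 * moment M 4 = moment M 2 - U ^+ 2 * moment M 0.
    by rewrite m1; ring.
  apply: H => [x|]; first by rewrite pE sqr_ge0.
  by exists (U + 1); rewrite pE addrC addKr expr1n oner_eq0.
have -> : moment M 2 / moment M 0 - U ^+ 2 =
    (moment M 2 - U ^+ 2 * moment M 0) / moment M 0.
  by rewrite mulrBl mulfK ?gt_eqF.
exact: divr_gt0.
Qed.

(** * Nodes of the two closures *)

(** Let C0 = M0, let C2, C3, C4 be the moments centred at the mean U, and put
    theta = C2 / C0.  Since the middle node is U, the outer nodes U + u1 and
    U + u3 have to match C1 = 0, C2, C3, C4, which forces u1 and u3 to be the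
    roots of u^2 - s u - P with s = C3 / C2 and P = (C4 - s C3) / C2, and
    the outer weights to have sum C2 / P.  The roots have opposite signs if P
    is positive, and mass is left for the middle node if theta < P.  As theta
    is positive, both follow from the positivity of M on
    ((v - U)^2 - s (v - U) - theta)^2, whose value is C4 - s C3 - theta C2. *)
Lemma hyqmom_primitive_exists (R : realType) (M : 'rV[R]_5) :
  strictly_realizable M -> hyqmom_primitive M !=set0.
Proof.
move=> Mi; have m0 := strictly_realizable_mass_gt0 Mi.
have := strictly_realizable_variance_gt0 Mi.
set U := moment M 1 / moment M 0; set theta := _ - U ^+ 2 => theta0.
set C0 := moment M 0 in m0.
have m1 : moment M 1 = U * C0 by rewrite divfK ?gt_eqF.
pose C2 := theta * C0.
have m2 : moment M 2 = C2 + U ^+ 2 * C0.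
  by rewrite /C2 /theta -/C0; field; rewrite gt_eqF.
have C2_gt0 : 0 < C2 by exact: mulr_gt0.
pose C3 := moment M 3 - 3 * U * C2 - U ^+ 3 * C0.
pose C4 := moment M 4 - 4 * U * C3 - 6 * U ^+ 2 * C2 - U ^+ 4 * C0.
have m3 : moment M 3 = C3 + 3 * U * C2 + U ^+ 3 * C0 by rewrite /C3; ring.
have m4 : moment M 4 = C4 + 4 * U * C3 + 6 * U ^+ 2 * C2 + U ^+ 4 * C0.
  by rewrite /C4; ring.
pose s := C3 / C2.
have C3E : C3 = s * C2 by rewrite divfK ?gt_eqF.
have kurt : 0 < C4 - s * C3 - theta * C2.
  (* v^2 + b v + c is (v - U)^2 - s (v - U) - theta, expanded. *)
  pose b := - 2 * U - s; pose c := U ^+ 2 + s * U - theta.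
  have pE x : c ^+ 2 + 2 * b * c * x + (b ^+ 2 + 2 * c) * x ^+ 2
      + 2 * b * x ^+ 3 + 1 * x ^+ 4 =
      ((x - U) ^+ 2 - s * (x - U) - theta) ^+ 2 by rewrite /b /c; ring.
  have -> : C4 - s * C3 - theta * C2 =
     c ^+ 2 * C0 + 2 * b * c * moment M 1 + (b ^+ 2 + 2 * c) * moment M 2
     + 2 * b * moment M 3 + 1 * moment M 4.
    by rewrite m1 m2 m3 m4 C3E /C2 /b /c; ring.
  apply: strictly_realizable_poly_gt0 => // [x|]; first by rewrite pE sqr_ge0.
  exists U; rewrite pE; apply: lt0r_neq0.
  by rewrite subrr expr0n mulr0 subr0 sub0r sqrrN exprn_gt0.
pose P := (C4 - s * C3) / C2.
have C4E : C4 = s * C3 + P * C2 by rewrite divfK ?gt_eqF//; ring.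
have P_gt : theta < P by rewrite ltr_pdivlMr// -subr_gt0.
have P_gt0 : 0 < P := lt_trans theta0 P_gt.
pose D := Num.sqrt (s ^+ 2 + 4 * P).
have D2_gt : s ^+ 2 < s ^+ 2 + 4 * P by rewrite ltrDl mulr_gt0.
have D2 : D ^+ 2 = s ^+ 2 + 4 * P.
  by rewrite sqr_sqrtr// (le_trans (sqr_ge0 s))// ltW.
have D_gt : `|s| < D.
  by rewrite -sqrtr_sqr ltr_sqrt// (le_lt_trans (sqr_ge0 s)).
have D_gt0 : 0 < D := le_lt_trans (normr_ge0 s) D_gt.
move: D_gt; rewrite ltr_norml => /andP[sD1 sD2].
pose u1 := (s - D) / 2; pose u3 := (s + D) / 2.
have u1_lt0 : u1 < 0 by rewrite /u1; lra.
have u3_gt0 : 0 < u3 by rewrite /u3; lra.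
have u13D : u3 - u1 = D by rewrite /u1 /u3; field.
have u13s : u1 + u3 = s by rewrite /u1 /u3; field.
have u13P : u1 * u3 = - P.
  apply: (@mulfI _ 4); first by rewrite pnatr_eq0.
  have -> : 4 * (u1 * u3) = s ^+ 2 - D ^+ 2 by rewrite /u1 /u3; field.
  by rewrite D2; ring.
pose r1 := C2 / (- u1 * D); pose r3 := C2 / (u3 * D).
have r1_gt0 : 0 < r1 by rewrite divr_gt0// mulr_gt0// oppr_gt0.
have r3_gt0 : 0 < r3 by rewrite divr_gt0// mulr_gt0.
have u1n : u1 != 0 by rewrite lt_eqF.
have u3n : u3 != 0 by rewrite gt_eqF.
have Dn : D != 0 by rewrite gt_eqF.
have e1 : r1 * u1 + r3 * u3 = 0.
  by rewrite /r1 /r3; field; rewrite Dn u3n u1n.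
have e2 : r1 * u1 ^+ 2 + r3 * u3 ^+ 2 = C2.
  rewrite /r1 /r3 -u13D; field.
  by rewrite ?u1n ?u3n u13D ?Dn.
have e3 : r1 * u1 ^+ 3 + r3 * u3 ^+ 3 = C3.
  by rewrite C3E -u13s -e2 -[LHS]subr0 -(mulr0 (- (u1 * u3))) -e1; ring.
have e4 : r1 * u1 ^+ 4 + r3 * u3 ^+ 4 = C4.
  by rewrite C4E -e3 -e2 -u13s -[P]opprK -u13P; ring.
have e0 : P * (r1 + r3) = C2.
  by rewrite -[RHS]subr0 -(mulr0 (u1 + u3)) -e1 -e2 -[P]opprK -u13P; ring.
pose r2 := C0 - r1 - r3.
have r2_gt0 : 0 < r2.
  rewrite /r2 -addrA -opprD subr_gt0 -(ltr_pM2l P_gt0) e0.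
  by rewrite /C2 ltr_pM2r.
exists (r1, r2, r3, U + u1, U + u3); split => //.
have C0E : C0 = r1 + r2 + r3 by rewrite /r2; ring.
apply: forall_le4; rewrite -/U.
- by rewrite -/C0 C0E; ring.
- by rewrite m1 -[LHS]addr0 -e1 C0E; ring.
- by rewrite m2 -[LHS]addr0 -(mulr0 (2 * U)) -e1 -e2 C0E; ring.
- by rewrite m3 -[LHS]addr0 -(mulr0 (3 * U ^+ 2)) -e1 -e2 -e3 C0E; ring.
- by rewrite m4 -[LHS]addr0 -(mulr0 (4 * U ^+ 3)) -e1 -e2 -e3 -e4 C0E; ring.
Qed.

Definition speed_weighted {R : realType} (s : seq (R * R)) : seq (R * R) :=
  [seq (p.1 * p.2, p.2) | p <- s].

(** What stability of the scheme requires of a closure: one set of nodes, lying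
    within the signal speeds, represents both the state and its flux. *)
Definition quadrature {R : realType} (c : closure_kind) (a : R)
    (M : 'rV[R]_5) (s : seq (R * R)) : Prop :=
  [/\ forall p, p \in s ->
        0 <= p.1 /\ delta_minus c a M <= p.2 <= delta_plus c a M,
      M = atomic s & flux c M = atomic (speed_weighted s)].

(** State and flux overlap in four components, so the representation amounts to
    the six moment equations of degrees 0 to 5. *)
Lemma quadratureP (R : realType) c (a : R) (M : 'rV[R]_5) s :
  (forall p, p \in s ->
     0 <= p.1 /\ delta_minus c a M <= p.2 <= delta_plus c a M) ->
  (forall k, (k <= 4)%N -> moment M k = \sum_(p <- s) p.1 * p.2 ^+ k) ->
  moment5 c M = \sum_(p <- s) p.1 * p.2 ^+ 5 ->
  quadrature c a M s.
Proof.
move=> sP sM sM5; split=> //.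
  by apply: eq_moment => k k4; rewrite sM// moment_atomic.
apply: eq_moment => k k4.
rewrite {1}/moment mxE inordK// moment_atomic//.
rewrite big_map /=; under eq_bigr do rewrite -mulrA -exprS.
by case: ltnP => k4'; [rewrite sM|rewrite (@anti_leq k 4) ?k4].
Qed.

Lemma hyqmom_quadrature (R : realType) (a : R) (M : 'rV[R]_5) :
  strictly_realizable M -> exists s, quadrature HyQMOM a M s.
Proof.
move=> Mi; have := xgetPex (0, 0, 0, 0, 0) (hyqmom_primitive_exists Mi).
rewrite -/(hyqmom_inv M); case E : (hyqmom_inv M) => [[[[r1 r2] r3] v1] v3].
set U := moment M 1 / moment M 0 => -[[r1_gt0 r2_gt0 r3_gt0] mE].
exists [:: (r1, v1); (r2, U); (r3, v3)]; apply: quadratureP.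
- rewrite /= E -/U => p; rewrite !inE => /or3P[] /eqP -> /=;
    by rewrite !ge_min !le_max !lexx ?orbT ltW.
- by move=> k k4; rewrite !big_cons big_nil mE //= addr0 addrA.
- by rewrite /= E !big_cons big_nil /= addr0 addrA.
Qed.

(** Gauss-Hermite quadrature with three points: the nodes v and v +- h, with
    h^2 = 3 sigma^2 and relative weights 2/3, 1/6, 1/6, have the same moments as
    the Gaussian of mean v and variance sigma^2 up to degree 5. *)
Lemma eqmom_quadrature (R : realType) (a : R) (M : 'rV[R]_5) :
  Num.sqrt 3 < a -> eqmom_primitive M !=set0 ->
  exists s, quadrature GaussianEQMOM a M s.
Proof.
move=> a_gt Mp; have := xgetPex (0, 0, 0, 0, 0) Mp.
rewrite -/(eqmom_inv M); case E : (eqmom_inv M) => [[[[r1 v1] r2] v2] sg].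
move=> [[r1_gt0 r2_gt0 sg_gt0]] [m0 m1 m2 m3 m4].
pose h := Num.sqrt 3 * sg.
have h2 : h ^+ 2 = 3 * sg ^+ 2 by rewrite exprMn sqr_sqrtr.
have h_gt0 : 0 < h by rewrite mulr_gt0// sqrtr_gt0.
have h_lt : h < a * sg by rewrite ltr_pM2r.
pose node (r v : R) : seq (R * R) :=
  [:: (2 / 3 * r, v); (1 / 6 * r, v + h); (1 / 6 * r, v - h)].
have nodeE (r v : R) k : \sum_(p <- node r v) p.1 * p.2 ^+ k =
    2 / 3 * r * v ^+ k + 1 / 6 * r * (v + h) ^+ k + 1 / 6 * r * (v - h) ^+ k.
  by rewrite !big_cons big_nil /= addr0 addrA.
have node0 r v : \sum_(p <- node r v) p.1 * p.2 ^+ 0 = r.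
  by rewrite nodeE; field.
have node1 r v : \sum_(p <- node r v) p.1 * p.2 ^+ 1 = r * v.
  by rewrite nodeE; field.
have node2 r v : \sum_(p <- node r v) p.1 * p.2 ^+ 2 = r * v ^+ 2 + sg ^+ 2 * r.
  by rewrite nodeE; field: h2.
have node3 r v : \sum_(p <- node r v) p.1 * p.2 ^+ 3 =
    r * v ^+ 3 + 3 * sg ^+ 2 * (r * v).
  by rewrite nodeE; field: h2.
have node4 r v : \sum_(p <- node r v) p.1 * p.2 ^+ 4 =
    r * v ^+ 4 + 6 * sg ^+ 2 * (r * v ^+ 2) + 3 * sg ^+ 4 * r.
  by rewrite nodeE; field: h2.
have node5 r v : \sum_(p <- node r v) p.1 * p.2 ^+ 5 =
    r * v ^+ 5 + 10 * sg ^+ 2 * (r * v ^+ 3) + 15 * sg ^+ 4 * (r * v).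
  by rewrite nodeE; field: h2.
exists (node r1 v1 ++ node r2 v2); apply: quadratureP.
- have nodeP r v p : 0 < r -> p \in node r v ->
      0 <= p.1 /\ v - a * sg <= p.2 <= v + a * sg.
    by move=> r0; rewrite !inE => /or3P[] /eqP -> /=; split; lra.
  move=> p; rewrite mem_cat /delta_minus /delta_plus E.
  by move=> /orP[] /nodeP[]// p0 /andP[pl pu];
    rewrite !ge_min !le_max pl pu ?orbT.
- apply: forall_le4; rewrite big_cat /= ?(node0,node1,node2,node3,node4).
  + exact: m0.
  + exact: m1.
  + by rewrite m2 m0; ring.
  + by rewrite m3 m1; ring.
  + by rewrite m4 m2 m0; ring.
- by rewrite big_cat !node5 /= E m3 m1; ring.
Qed.

(** * Transport by the HLL flux *)

Lemma delta_plus_ge0 (R : realType) c (a : R) (M : 'rV[R]_5) :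
  0 <= delta_plus c a M.
Proof.
case: c => /=.
  by case: (eqmom_inv M) => [[[[? ?] ?] ?] ?]; rewrite le_max lexx orbT.
by case: (hyqmom_inv M) => [[[[? ?] ?] ?] ?]; rewrite le_max lexx orbT.
Qed.

Lemma delta_minus_le0 (R : realType) c (a : R) (M : 'rV[R]_5) :
  delta_minus c a M <= 0.
Proof.
case: c => /=.
  by case: (eqmom_inv M) => [[[[? ?] ?] ?] ?]; rewrite ge_min lexx orbT.
by case: (hyqmom_inv M) => [[[[? ?] ?] ?] ?]; rewrite ge_min lexx orbT.
Qed.

Lemma atomic_reweight (R : realType) (s : seq (R * R)) (e f : R) :
  atomic [seq (p.1 * (e + f * p.2), p.2) | p <- s] =
  e *: atomic s + f *: atomic (speed_weighted s).
Proof.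
rewrite /atomic /speed_weighted !big_map !scaler_sumr -big_split /=.
by apply: eq_bigr => p _; rewrite !scalerA -scalerDl; congr (_ *: _); ring.
Qed.

(** On the nodes, multiplication by e + f x acts as the combination of state and
    flux with coefficients e and f. *)
Lemma realizable_state_flux (R : realType) c (a : R) (M : 'rV[R]_5) s
    (e f : R) :
  quadrature c a M s ->
  (forall x, delta_minus c a M <= x <= delta_plus c a M -> 0 <= e + f * x) ->
  realizable (e *: M + f *: flux c M).
Proof.
move=> [sP Ms Fs] ef; rewrite Fs [in X in e *: X]Ms -atomic_reweight.
apply: realizable_atomic => _ /mapP[p /sP[p0 px] ->] /=.
by rewrite mulr_ge0// ef.
Qed.

(** The share of an atom that the HLL flux carries across an interface whose
    wave fan has width w: it cannot exceed the half of the cell that feeds the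
    interface.  If w = 0 the convention 0^-1 = 0 makes it vanish. *)
Lemma hll_weight (R : realType) (lambda w y z : R) :
  0 <= lambda -> lambda * w <= 1 / 2 -> 0 <= y <= w -> 0 <= z <= w ->
  0 <= lambda * w^-1 * z * y <= 1 / 2.
Proof.
move=> l0 lw /andP[y0 yw] /andP[z0 zw].
have w0 : 0 <= w := le_trans y0 yw.
rewrite !mulr_ge0 ?invr_ge0//= (le_trans _ lw)//.
have -> : lambda * w^-1 * z * y = lambda * z * (y / w) by ring.
apply: (@le_trans _ _ (lambda * z)); last exact: ler_wpM2l.
rewrite ler_piMr ?mulr_ge0//.
have [w_gt0|] := ltP 0 w; first by rewrite ler_pdivrMr// mul1r.
by move=> w_le0; rewrite (@le_anti _ _ w 0) ?w_le0// invr0 mulr0.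
Qed.

Section HLL.
Variables (R : realType) (c : closure_kind) (a lambda : R).
Variables Mm Mp : 'rV[R]_5.
Hypothesis qm : exists s, quadrature c a Mm s.
Hypothesis qp : exists s, quadrature c a Mp s.
Hypothesis lambda_ge0 : 0 <= lambda.

Let dp := speed_plus c a Mm Mp.
Let dm := speed_minus c a Mm Mp.

Hypothesis cfl : lambda * (dp - dm) <= 1 / 2.

Let dp_ge0 : 0 <= dp.
Proof. by rewrite le_max delta_plus_ge0. Qed.

Let dm_le0 : dm <= 0.
Proof. by rewrite ge_min delta_minus_le0. Qed.

Let state_bounds x (M : 'rV[R]_5) : M = Mm \/ M = Mp ->
  delta_minus c a M <= x <= delta_plus c a M -> dm <= x <= dp.
Proof.
move=> MM /andP[xm xp]; rewrite /dm /dp /speed_minus /speed_plus.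
by case: MM xm xp => -> xm xp; rewrite ge_min le_max xm xp ?orbT.
Qed.

Let weightP y z : 0 <= y <= dp - dm -> 0 <= z <= dp - dm ->
  0 <= lambda * (dp - dm)^-1 * z * y <= 1 / 2.
Proof. exact: hll_weight. Qed.

(** On an atom x of [Mm] the weight is multiplied by
    1/2 - lambda dp (x - dm) / (dp - dm), and on an atom x of [Mp] by
    - lambda dm (dp - x) / (dp - dm); both factors are nonnegative by
    [hll_weight]. *)
Lemma hll_outflow_realizable :
  realizable ((1 / 2) *: Mm - lambda *: hll_flux c a Mm Mp).
Proof.
have [[sm qsm] [sp qsp]] := (qm, qp).
pose k := lambda * (dp - dm)^-1.
have -> : (1 / 2) *: Mm - lambda *: hll_flux c a Mm Mp =
    ((1 / 2 + k * dp * dm) *: Mm + (- (k * dp)) *: flux c Mm) +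
    ((- (k * dp * dm)) *: Mp + (k * dm) *: flux c Mp).
  by rewrite /hll_flux -/dp -/dm /k; apply/rowP => j; rewrite !mxE; ring.
apply: realizableD.
- apply: (realizable_state_flux qsm) => x /(state_bounds (or_introl erefl)).
  move=> /andP[xm xp]; have [||_] := andP (@weightP (x - dm) dp _ _).
  + lra.
  + by rewrite dp_ge0 lerDl oppr_ge0.
  + by rewrite -/k; lra.
- apply: (realizable_state_flux qsp) => x /(state_bounds (or_intror erefl)).
  move=> /andP[xm xp]; have [||+ _] := andP (@weightP (dp - x) (- dm) _ _).
  + lra.
  + by rewrite oppr_ge0 dm_le0 lerDr.
  + by rewrite -/k; lra.
Qed.

(** The mirror image: the atoms of [Mm] enter with the factor
    lambda dp (x - dm) / (dp - dm), those of [Mp] are kept with the factor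
    1/2 + lambda dm (dp - x) / (dp - dm). *)
Lemma hll_inflow_realizable :
  realizable ((1 / 2) *: Mp + lambda *: hll_flux c a Mm Mp).
Proof.
have [[sm qsm] [sp qsp]] := (qm, qp).
pose k := lambda * (dp - dm)^-1.
have -> : (1 / 2) *: Mp + lambda *: hll_flux c a Mm Mp =
    ((- (k * dp * dm)) *: Mm + (k * dp) *: flux c Mm) +
    ((1 / 2 + k * dp * dm) *: Mp + (- (k * dm)) *: flux c Mp).
  by rewrite /hll_flux -/dp -/dm /k; apply/rowP => j; rewrite !mxE; ring.
apply: realizableD.
- apply: (realizable_state_flux qsm) => x /(state_bounds (or_introl erefl)).
  move=> /andP[xm xp]; have [||+ _] := andP (@weightP (x - dm) dp _ _).
  + lra.
  + by rewrite dp_ge0 lerDl oppr_ge0.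
  + by rewrite -/k; lra.
- apply: (realizable_state_flux qsp) => x /(state_bounds (or_intror erefl)).
  move=> /andP[xm xp]; have [||_] := andP (@weightP (dp - x) (- dm) _ _).
  + lra.
  + by rewrite oppr_ge0 dm_le0 lerDr.
  + by rewrite -/k; lra.
Qed.

End HLL.

(** * Moments of the Gaussian density *)

Local Notation mu := lebesgue_measure.

Lemma integral_exhaustion (R : realType) (f : R -> R) :
  mu.-integrable setT (EFin \o f) ->
  (\int[mu]_(x in `[(- n.+1%:R)%R, n.+1%:R]) (f x)%:E)%E @[n --> \oo] -->
  (\int[mu]_x (f x)%:E)%E.
Proof.
move=> fI; have mf := measurable_int _ fI.
under eq_fun do rewrite integral_mkcond.
have [|||||_ _] := @dominated_convergence _ _ R (@lebesgue_measure R) setT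
  measurableT (fun n => (EFin \o f) \_ `[(- n.+1%:R)%R, n.+1%:R])
  (EFin \o f) (abse \o (EFin \o f)).
- move=> n; apply/(measurable_restrictT (EFin \o f)) => //.
  exact: measurable_funTS.
- by [].
- apply: aeW => x _; apply: cvg_near_cst.
  near=> n; rewrite patchE mem_set//= in_itv/= -ler_norml.
  suff xn : `|x| <= n%:R by apply: (le_trans xn); rewrite ler_nat.
  by near: n; exact: nbhs_infty_ger.
- exact: integrable_abse.
- apply: aeW => x n _; rewrite patchE; case: ifP => //= _.
  by rewrite normr0 lee_fin.
- exact.
Unshelve. all: by end_near.
Qed.

(** The bound makes [F] vanish at infinity like 1/x; the integral of its
    derivative over [-n, n] is F(n) - F(-n), which tends to 0. *)
Lemma integral_derivative_eq0 (R : realType) (f F : R -> R) (B : R) :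
  continuous f -> (forall x : R, is_derive x 1 F (f x)) ->
  mu.-integrable setT (EFin \o f) -> (forall x, `|x * F x| <= B) ->
  (\int[mu]_x (f x)%:E)%E = 0%E.
Proof.
move=> cf dF fI FB.
have cF : continuous F.
  by move=> x; apply/differentiable_continuous/derivable1_diffP; case: (dF x).
have FTC n : (\int[mu]_(x in `[(- n.+1%:R)%R, n.+1%:R]) (f x)%:E)%E =
    (F n.+1%:R - F (- n.+1%:R))%:E.
  have n1 : - n.+1%:R < n.+1%:R :> R by rewrite gtrN.
  rewrite EFinB; apply: continuous_FTC2 => //.
  - exact: continuous_subspaceT.
  - split; first by move=> x _; case: (dF x).
      by apply: cvg_at_right_filter; exact: cF.
    by apply: cvg_at_left_filter; exact: cF.
  - by move=> x _; rewrite derive1E; exact: derive_val.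
have increments : (F n.+1%:R - F (- n.+1%:R))%:E @[n --> \oo] -->
    (\int[mu]_x (f x)%:E)%E.
  by rewrite -(funext FTC); exact: integral_exhaustion.
have bound x : 0 < x -> `|F x| <= B * x^-1 /\ `|F (- x)| <= B * x^-1.
  move=> x0; rewrite !ler_pdivlMr//.
  have := FB x; have := FB (- x).
  by rewrite !normrM normrN (gtr0_norm x0) ![x * _]mulrC.
have vanish : F n.+1%:R - F (- n.+1%:R) @[n --> \oo] --> (0 : R).
  apply: (@squeeze_cvgr _ _ _ _ (fun n => - (2 * B) * harmonic n)
    (fun n => (2 * B) * harmonic n) _).
  - apply: nearW => n /=; have [] := bound n.+1%:R (ltr0Sn _ _).
    rewrite !ler_norml /harmonic /=.
    move: (F _) (F _) (_^-1) => y z t /andP[? ?] /andP[? ?].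
    by apply/andP; split; lra.
  - rewrite -[X in _ --> X](mulr0 (- (2 * B))).
    by apply: cvgMl_tmp; exact: cvg_harmonic.
  - rewrite -[X in _ --> X](mulr0 (2 * B)).
    by apply: cvgMl_tmp; exact: cvg_harmonic.
apply: (cvg_unique _ increments) => //.
by apply: cvg_EFin; [exact: nearW|exact: vanish].
Qed.

Lemma sqr_le_expR (R : realType) (y : R) :
  0 <= y -> y ^+ 2 <= 8 * expR (3 / 4 * y).
Proof.
move=> y0; have e0 : 1 + 3 / 8 * y <= expR (3 / 8 * y) by exact: expR_ge1Dx.
have -> : 3 / 4 * y = 3 / 8 * y + 3 / 8 * y by field.
rewrite expRD -expr2.
have : (1 + 3 / 8 * y) ^+ 2 <= expR (3 / 8 * y) ^+ 2.
  by rewrite lerXn2r// ?nnegrE ?expR_ge0//; lra.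
by nra.
Qed.

(** Doubling the standard deviation turns exp(-y) into exp(-y/4), so that a
    factor exp(-3y/4) is left to absorb the monomial, whose modulus
    is bounded by a quadratic polynomial in y = (v - U)^2 / (2 s^2). *)
Lemma normal_tail (R : realType) (U s : R) : s != 0 ->
  exists C, forall k v, (k <= 4)%N ->
    `|v ^+ k * normal_pdf U s v| <= C * normal_pdf U (2 * s) v.
Proof.
move=> s0.
have s20 : 2 * s != 0 by rewrite mulf_neq0.
(* 256 = 8 * 4 * 8: from v^4 <= 8 U^4 + 8 (v - U)^4, from
   (v - U)^4 = 4 s^4 y^2 and from [sqr_le_expR]. *)
pose A := 1 + 8 * U ^+ 4 + 256 * s ^+ 4.
have A0 : 0 <= A.
  by rewrite /A !addr_ge0// mulr_ge0// exprn_even_ge0.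
exists (normal_peak s * A * (normal_peak (2 * s))^-1) => k v k4.
rewrite !normal_pdfE//=.
have p2 : normal_peak (2 * s) != 0 by rewrite gt_eqF// normal_peak_gt0.
have -> : normal_peak s * A / normal_peak (2 * s) *
    (normal_peak (2 * s) * normal_fun U (2 * s) v) =
    normal_peak s * (A * normal_fun U (2 * s) v) by field.
rewrite mulrCA normrM ger0_norm ?normal_peak_ge0//.
rewrite ler_wpM2l ?normal_peak_ge0// normrM normrX.
rewrite (ger0_norm (normal_fun_ge0 _ _ _)).
pose y := (v - U) ^+ 2 / (2 * s ^+ 2).
have y0 : 0 <= y by rewrite divr_ge0 ?sqr_ge0// mulr_ge0// sqr_ge0.
have -> : normal_fun U s v = expR (- y).
  by rewrite /normal_fun /y mulr_natl mulNr.
have -> : normal_fun U (2 * s) v = expR (- (y / 4)).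
  by rewrite /normal_fun /y mulNr; congr (expR (- _)); field.
have -> : expR (- y) = expR (- (3 / 4 * y)) * expR (- (y / 4)).
  by rewrite -expRD; congr expR; field.
rewrite mulrA ler_wpM2r ?expR_ge0//.
have -> : A = A * expR (3 / 4 * y) * expR (- (3 / 4 * y)).
  by rewrite -mulrA -expRD subrr expR0 mulr1.
rewrite ler_wpM2r ?expR_ge0//.
have e1 : 1 <= expR (3 / 4 * y).
  by rewrite -[X in X <= _]expR0 ler_expR mulr_ge0.
have v4 : `|v| ^+ k <= 1 + v ^+ 4.
  rewrite -[v ^+ 4]ger0_norm ?exprn_even_ge0// normrX.
  have := normr_ge0 v; move: (`|v|) => w w0.
  have [w1|w1] := leP w 1.
    by rewrite (le_trans (exprn_ile1 _ w0 w1))// lerDl exprn_ge0.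
  by rewrite (le_trans (ler_weXn2l (ltW w1) k4))// lerDr.
apply: (le_trans v4).
have vU : v ^+ 4 <= 8 * U ^+ 4 + 8 * (v - U) ^+ 4.
  have -> : 8 * U ^+ 4 + 8 * (v - U) ^+ 4 = v ^+ 4 +
      (4 * (U ^+ 2 - (v - U) ^+ 2) ^+ 2
       + (v - 2 * U) ^+ 2 * (2 * (U ^+ 2 + (v - U) ^+ 2) + v ^+ 2)) by ring.
  rewrite lerDl.
  by do ![exact: sqr_ge0|apply: addr_ge0|apply: mulr_ge0].
have yE : (v - U) ^+ 4 = 4 * s ^+ 4 * y ^+ 2.
  by rewrite /y; field.
have := sqr_le_expR y0.
move: (expR _) e1 => E e1 yE2.
have : 32 * s ^+ 4 * y ^+ 2 <= 32 * s ^+ 4 * (8 * E).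
  by rewrite ler_wpM2l// mulr_ge0// exprn_even_ge0.
have : 1 + 8 * U ^+ 4 <= (1 + 8 * U ^+ 4) * E.
  by rewrite ler_peMr// addr_ge0// mulr_ge0// exprn_even_ge0.
by rewrite /A; lra.
Qed.

Lemma integrable_moment_normal (R : realType) (U s : R) k : s != 0 ->
  (k <= 4)%N ->
  mu.-integrable setT (fun v : R => (v ^+ k * normal_pdf U s v)%:E).
Proof.
move=> s0 k4; have [C tail] := normal_tail U s0.
have gI := integrableZl measurableT C (integrable_normal_pdf U (2 * s)).
apply: (le_integrable measurableT _ _ gI) => [|v _].
  apply/measurable_EFinP; apply: measurable_funM; first exact: measurable_funX.
  exact: measurable_normal_pdf.
rewrite -EFinM /= lee_fin (le_trans (tail k v k4))//.
exact: ler_norm.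
Qed.

Lemma is_derive_moment_normal (R : realType) (U s : R) k (v : R) : s != 0 ->
  is_derive v 1 (fun x : R => x ^+ k * normal_pdf U s x)
    (k%:R * (v ^+ k.-1 * normal_pdf U s v)
     - s ^- 2 * (v ^+ k.+1 * normal_pdf U s v
                 - U * (v ^+ k * normal_pdf U s v))).
Proof.
move=> s0; rewrite normal_pdfE//=.
pose q : R -> R := (- (s ^+ 2 *+ 2)^-1) *: (id - cst U) ^+ 2.
have -> : (fun x => x ^+ k * (normal_peak s * normal_fun U s x)) =
    (@id R) ^+ k * (normal_peak s *: (expR \o q)).
  apply/funext => x; rewrite /q /= !fctE /normal_fun /=.
  congr (_ * (_ * expR _)); rewrite /GRing.scale/=.
  by rewrite mulNr mulrC mulNr.
have dq : is_derive v 1 q (- (s ^+ 2 *+ 2)^-1 *: ((v - U) *+ 2)).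
  rewrite /q; apply: is_derive_eq.
  by rewrite /GRing.scale /= subr0 mulr1 expr1 mulr_natl.
have dE := is_derive1_comp (is_derive_expR (q v)) dq.
have -> : normal_fun U s v = expR (q v) 
  by rewrite /normal_fun /q !fctE /GRing.scale /= mulrC mulNr mulrN.
apply: is_derive_eq; rewrite !fctE /GRing.scale /= [v ^+ k.+1]exprS.
move: (expR _) (normal_peak s) (v ^+ k) (v ^+ k.-1) k%:R => e p a b m.
rewrite -(mulr_natl (s ^+ 2)) -(mulr_natl (v - U)) mulr1.
have -> : (2 * s ^+ 2)^-1 = 2^-1 * s ^- 2 by rewrite invfM.
move: (s ^- 2) => w.
have -> : - (2^-1 * w) * (2 * (v - U)) = - (w * (v - U)).
  by rewrite mulNr mulrACA mulVf ?mul1r.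
by ring.
Qed.

Definition normal_moment {R : realType} (U s : R) (k : nat) : R :=
  \int[mu]_(v in setT) (v ^+ k * normal_pdf U s v).

(** Stein's identity for v^k: the derivative of v^k times the density integrates
    to 0. *)
Lemma normal_moment_rec (R : realType) (U s : R) k : s != 0 -> (k < 4)%N ->
  normal_moment U s k.+1 =
  U * normal_moment U s k + s ^+ 2 * (k%:R * normal_moment U s k.-1).
Proof.
move=> s0 k4; have [C tail] := normal_tail U s0.
pose g j (v : R) := v ^+ j * normal_pdf U s v.
have gC j : continuous (g j).
  move=> v; apply: cvgM; last exact: continuous_normal_pdf.
  exact: exprn_continuous.
have gI j : (j <= 4)%N -> mu.-integrable setT (EFin \o g j).
  exact: integrable_moment_normal.
have I1 := gI _ (leq_trans (leq_pred k) (ltnW k4)).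
have I2 := gI _ k4; have I3 := gI _ (ltnW k4).
have Z1 : mu.-integrable setT (EFin \o (fun v => k%:R * g k.-1 v)).
  exact: (integrableZl measurableT k%:R I1).
have Z3 : mu.-integrable setT (EFin \o (fun v => U * g k v)).
  exact: (integrableZl measurableT U I3).
have B23 : mu.-integrable setT (EFin \o (fun v => g k.+1 v - U * g k v)).
  exact: (integrableB measurableT I2 Z3).
have ZB : mu.-integrable setT
    (EFin \o (fun v => s ^- 2 * (g k.+1 v - U * g k v))).
  exact: (integrableZl measurableT (s ^- 2) B23).
pose f v := k%:R * g k.-1 v - s ^- 2 * (g k.+1 v - U * g k v).
have fI : mu.-integrable setT (EFin \o f).
  exact: (integrableB measurableT Z1 ZB).
have fC : continuous f.
  move=> v; apply: cvgB; apply: cvgMl_tmp; first exact: gC.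
  by apply: cvgB; [exact: gC|apply: cvgMl_tmp; exact: gC].
have bound v : `|v * g k v| <= `|C| * normal_peak (2 * s).
  rewrite /g mulrA -exprS (le_trans (tail _ _ k4))//.
  apply: (le_trans (ler_wpM2r (normal_pdf_ge0 _ _ _) (ler_norm C))).
  by rewrite ler_wpM2l// normal_pdf_ub// mulf_neq0.
have f0 := integral_derivative_eq0 fC
  (fun v => is_derive_moment_normal U k v s0) fI bound.
have : \int[mu]_(v in setT) f v = 0 by rewrite /Rintegral f0.
rewrite (RintegralB measurableT Z1 ZB).
rewrite (RintegralZl _ measurableT I1) (RintegralZl _ measurableT B23).
rewrite (RintegralB measurableT I2 Z3) (RintegralZl _ measurableT I3).
rewrite -!/(normal_moment _ _ _) => /eqP; rewrite subr_eq0 => /eqP ->.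
by rewrite mulVKf ?expf_neq0// addrC subrK.
Qed.

Lemma normal_moment0 (R : realType) (U s : R) : normal_moment U s 0 = 1.
Proof.
rewrite /normal_moment /Rintegral; under eq_integral do rewrite expr0 mul1r.
by rewrite integral_normal_pdf.
Qed.

Lemma maxwellianE (R : realType) (U theta : R) k : 0 < theta -> (k <= 4)%N ->
  moment (maxwellian U theta) k = normal_moment U (Num.sqrt theta) k.
Proof.
move=> theta0 k4; rewrite /moment mxE inordK//.
have s0 : Num.sqrt theta != 0 by rewrite gt_eqF// sqrtr_gt0.
apply: eq_Rintegral => v _; rewrite normal_pdfE//= /normal_peak /normal_fun.
rewrite sqr_sqrtr ?(ltW theta0)//.
rewrite -(mulr_natl theta) -(mulr_natl (theta * pi)) (mulrC theta) (mulrA 2).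
by congr (_ * _); rewrite mulrC.
Qed.

(** * Quadrature of the Maxwellian and relaxation *)

Definition maxwellian_node {R : realType} (U theta : R) (j : 'I_5) : R :=
  U + (j%:R - 2) * Num.sqrt theta.

(** The solution of the moment equations of the standard Gaussian, of degrees
    0 to 4, on the symmetric nodes -2, -1, 0, 1, 2. *)
Definition maxwellian_weight {R : realType} (j : 'I_5) : R :=
  [:: 1 / 12; 1 / 6; 1 / 2; 1 / 6; 1 / 12]`_j.

(** A Gauss-Hermite rule with three nodes would match these moments as well;
    five nodes are what [strictly_realizableD5] requires. *)
Lemma maxwellian_quadrature (R : realType) (U theta : R) : 0 < theta ->
  maxwellian U theta =
  \sum_j maxwellian_weight j *: powers (maxwellian_node U theta j).
Proof.
move=> theta0; set s := Num.sqrt theta.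
have s0 : s != 0 by rewrite gt_eqF// sqrtr_gt0.
have n0 := normal_moment0 U s.
have n1 := @normal_moment_rec R U s 0 s0 isT.
have n2 := @normal_moment_rec R U s 1 s0 isT.
have n3 := @normal_moment_rec R U s 2 s0 isT.
have n4 := @normal_moment_rec R U s 3 s0 isT.
rewrite /= in n1 n2 n3 n4.
apply: eq_moment => k k4; rewrite maxwellianE// -/s.
rewrite /moment summxE.
under eq_bigr do rewrite !mxE inordK//.
rewrite !big_ord_recr big_ord0 /= /maxwellian_weight /maxwellian_node /= -/s.
move: k k4; apply: forall_le4.
- by rewrite n0; field.
- by rewrite n1 n0; field.
- by rewrite n2 n1 n0; field.
- by rewrite n3 n2 n1 n0; field.
- by rewrite n4 n3 n2 n1 n0; field.
Qed.

Lemma maxwellian_node_inj (R : realType) (U theta : R) : 0 < theta ->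
  injective (maxwellian_node U theta).
Proof.
move=> theta0 i j /addrI /mulIf.
rewrite gt_eqF ?sqrtr_gt0// => /(_ isT) /addIr /eqP.
by rewrite eqr_nat => /eqP /val_inj.
Qed.

Lemma maxwellian_weight_gt0 (R : realType) j : 0 < maxwellian_weight j :> R.
Proof.
rewrite /maxwellian_weight; have := ltn_ord j.
by case: (nat_of_ord j) => [|[|[|[|[|]]]]] //= _; rewrite divr_gt0.
Qed.

Lemma recon_average (R : realType) (dx : R) (M : int -> 'rV[R]_5) i :
  M i = (1 / 2) *: recon_minus dx M i + (1 / 2) *: recon_plus dx M (i - 1).
Proof.
rewrite /recon_minus /recon_plus subrK.
by apply/rowP => k; rewrite !mxE; field.
Qed.

Lemma cfl_interface (R : realType) (lambda : R) (gap : int -> R) :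
  0 <= lambda ->
  (lambda%:E * ereal_sup [set (gap i)%:E | i in setT] <= (1 / 2)%:E)%E ->
  forall i, lambda * gap i <= 1 / 2.
Proof.
move=> l0 cfl i; rewrite -lee_fin EFinM; apply: le_trans cfl.
by apply: lee_wpmul2l; [rewrite lee_fin|apply: ereal_sup_ubound; exists i].
Qed.

(** Solved for [N'], the implicit relaxation step is
    (N + kappa rho Delta) / (1 + kappa). *)
Lemma relaxation_strictly_realizable (R : realType) (kappa : R)
    (M N N' : 'rV[R]_5) :
  0 < kappa -> strictly_realizable M -> realizable N ->
  N' = N + kappa *: (rho_maxwellian M - N') -> strictly_realizable N'.
Proof.
move=> k0 Mi Nr N'E.
have k1_gt0 : 0 < 1 + kappa by rewrite addr_gt0.
have rho_gt0 := strictly_realizable_mass_gt0 Mi.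
have theta_gt0 := strictly_realizable_variance_gt0 Mi.
set U := moment M 1 / moment M 0 in theta_gt0.
set theta := _ - _ in theta_gt0.
pose w j := (1 + kappa)^-1 * (kappa * (moment M 0 * maxwellian_weight j)).
have -> : N' = (1 + kappa)^-1 *: N +
    \sum_j w j *: powers (maxwellian_node U theta j).
  have -> : \sum_j w j *: powers (maxwellian_node U theta j) =
      (1 + kappa)^-1 *: (kappa *: rho_maxwellian M).
    rewrite /rho_maxwellian -/U -/theta maxwellian_quadrature// !scaler_sumr.
    by apply: eq_bigr => j _; rewrite !scalerA /w !mulrA.
  rewrite -scalerDr; apply: (scalerI (lt0r_neq0 k1_gt0)).
  rewrite scalerA divff ?gt_eqF// scale1r.
  by rewrite scalerDl scale1r {1}N'E scalerBr addrA subrK.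
apply: strictly_realizableD5.
- exact: maxwellian_node_inj.
- by move=> j; rewrite !mulr_gt0 ?invr_gt0 ?maxwellian_weight_gt0.
- by apply: realizableZ => //; rewrite invr_ge0 ltW.
Qed.

Theorem corollary3p8 (R : realType) (c : closure_kind) (a tau dx : R)
    (dt : nat -> R) (Mbar : nat -> int -> 'rV[R]_5) (n : nat)
    (a_gt : Num.sqrt 3 < a) (tau_gt0 : 0 < tau) (dx_gt0 : 0 < dx)
    (dt_gt0 : 0 < dt n)
    (scheme : forall i : int,
       Mbar n.+1 i =
         Mbar n i
         - (dt n / dx) *: (num_flux c a dx (Mbar n) i
                           - num_flux c a dx (Mbar n) (i - 1))
         + (dt n / tau) *: (rho_maxwellian (Mbar n i) - Mbar n.+1 i))
    (cell_real : forall i : int, strictly_realizable (Mbar n i))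
    (recon_real : forall i : int,
       strictly_realizable (recon_minus dx (Mbar n) i) /\
       strictly_realizable (recon_plus dx (Mbar n) i))
    (eqmom_exists : c = GaussianEQMOM -> forall i : int,
       eqmom_primitive (recon_minus dx (Mbar n) i) !=set0 /\
       eqmom_primitive (recon_plus dx (Mbar n) i) !=set0)
    (cfl : ((dt n / dx)%:E *
              ereal_sup [set (speed_gap c a dx (Mbar n) i)%:E | i in setT]
            <= (1 / 2)%:E)%E) :
  forall i : int, strictly_realizable (Mbar n.+1 i).
Proof.
move=> i.
have lambda_ge0 : 0 <= dt n / dx by rewrite divr_ge0 ?ltW.
have cfl_at := cfl_interface lambda_ge0 cfl.
have quad j : (exists s, quadrature c a (recon_minus dx (Mbar n) j) s) /\
    (exists s, quadrature c a (recon_plus dx (Mbar n) j) s).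
  case: c eqmom_exists {scheme cfl cfl_at} => [/(_ erefl j)[pm pp]|_].
    by split; exact: eqmom_quadrature.
  by have [rm rp] := recon_real j; split; exact: hyqmom_quadrature.
apply: (relaxation_strictly_realizable (divr_gt0 dt_gt0 tau_gt0)
  (cell_real i) _ (scheme i)).
have [qm qp] := quad i; have [qm' qp'] := quad (i - 1).
rewrite {1}(recon_average dx (Mbar n) i).
rewrite [X in _ - X]scalerBr opprB [X in _ + X]addrC addrACA.
apply: realizableD; first exact: hll_outflow_realizable (cfl_at i).
exact: hll_inflow_realizable (cfl_at (i - 1)).
Qed.
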